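(* Suppose $0<\lambda<1$, $0<\epsilon<1$, $0<\delta\leq 1/2$, and $0\leq r<1$. Put $\nu=1-\lambda$. Then the conditions of soundness and robustness, $$\bar{\epsilon}_{\lambda}(k,N,\delta)\leq\epsilon\qquad\text{and}\qquad B_{N,k}(\nu r\epsilon)\geq 1-\delta,$$ hold as long as the integers $N$ and $k$ satisfy $$k=\left\lfloor\left(\frac{\lambda\sqrt{2\nu}+r}{\lambda\sqrt{2\nu}+1}\right)\nu\epsilon N\right\rfloor,\qquad N\geq\left\lceil\left[\frac{\lambda\sqrt{2\nu}+1}{\lambda\nu(1-r)}\right]^2\frac{\ln\delta^{-1}+4\lambda\nu^2}{\epsilon}\right\rceil.$$
   Context: Binomial distribution function: $B_{N,k}(p)=\sum_{j=0}^k\binom{N}{j}p^j(1-p)^{N-j}$ (with $x^0=1$ even for $x=0$). Target state. Let $d$ be a prime, $n\ge 1$, $\mathcal{H}=(\mathbb{C}^d)^{\otimes n}$, $\omega=e^{2\pi \mathrm{i}/d}$, and let $Z|j\rangle=\omega^j|j\rangle$ for $j\in\mathbb{Z}_d$. Given a graph with vertex set $\{1,\dots,n\}$, edge set $E$ (edges join distinct vertices) and multiplicities $m_e\in\mathbb{Z}_d$ for $e\in E$, the qudit graph state is $|G\rangle=\big(\prod_{e\in E}\mathrm{CZ}_e^{m_e}\big)|+\rangle^{\otimes n}\in\mathcal{H}$, where $|+\rangle=d^{-1/2}\sum_{j\in\mathbb{Z}_d}|j\rangle$ and $\mathrm{CZ}_{(i,j)}=\sum_{k\in\mathbb{Z}_d}|k\rangle\langle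 k|_i\otimes Z_j^k$. Strategy. For a parameter $\lambda$ put $\nu=1-\lambda$, $\Omega=|G\rangle\langle G|+\lambda(\mathbb{1}-|G\rangle\langle G|)$ and $\overline{\Omega}=\mathbb{1}-\Omega$. Guaranteed infidelity. For integers $0\leq k\leq N-1$ and a permutation-invariant density operator $\rho$ on $\mathcal{H}^{\otimes(N+1)}$ (i.e. invariant under conjugation by all permutations of the $N+1$ tensor factors), let $$p_k(\rho)=\sum_{i=0}^k\binom{N}{i}\operatorname{tr}\big([\Omega^{\otimes(N-i)}\otimes\overline{\Omega}^{\otimes i}\otimes\mathbb{1}]\rho\big),\qquad f_k(\rho)=\sum_{i=0}^k\binom{N}{i}\operatorname{tr}\big([\Omega^{\otimes(N-i)}\otimes\overline{\Omega}^{\otimes i}\otimes|G\rangle\langle G|]\rho\big),$$ and $F_k(\rho)=f_k(\rho)/p_k(\rho)$ when $p_k(\rho)>0$. For $0<\delta\leq 1$ define $$\bar{\epsilon}_{\lambda}(k,N,\delta)=1-\min_{\rho}\{F_k(\rho)\mid p_k(\rho)\geq\delta\},$$ the minimum being over permutation-invariant density operators $\rho$ on $\mathcal{H}^{\otimes(N+1)}$. *)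

(* Defs.v *)
From HB Require Import structures.
From mathcomp Require Import all_boot all_order all_fingroup all_algebra.
From mathcomp Require Import spectral complex.
From mathcomp Require Import boolp classical_sets reals exp trigo.

Set Implicit Arguments.
Unset Strict Implicit.
Unset Printing Implicit Defensive.

Import Order.TTheory GRing.Theory Num.Theory.
Local Open Scope ring_scope.
Local Open Scope complex_scope.
Local Open Scope sesquilinear_scope.

Definition binom_cdf (R : realType) (N k : nat) (p : R) : R :=
  \sum_(j < k.+1) 'C(N, j)%:R * p ^+ j * (1 - p) ^+ (N - j).

(* (C^D)^{(x) n} has its product basis indexed by the functions from the n
   tensor factors to the D basis vectors of one factor; [tens_idx] reads off
   the function encoded by a matrix index. *)
Definition tensdim (n D : nat) : nat := #|{ffun 'I_n -> 'I_D}|.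

Definition tens_idx (n D : nat) (a : 'I_(tensdim n D)) : {ffun 'I_n -> 'I_D} :=
  enum_val a.

Definition tens_op (C : comPzRingType) (n D : nat) (A : 'I_n -> 'M[C]_D) :
    'M[C]_(tensdim n D) :=
  \matrix_(a, b) \prod_(l < n) A l (tens_idx a l) (tens_idx b l).

Definition tens_ket (C : comPzRingType) (n D : nat) (v : 'I_n -> 'cV[C]_D) :
    'cV[C]_(tensdim n D) :=
  \col_a \prod_(l < n) v l (tens_idx a l) ord0.

(* The unitary permuting the n tensor factors of (C^D)^{(x) n} by s. *)
Definition perm_op (C : comPzRingType) (n D : nat) (s : 'S_n) :
    'M[C]_(tensdim n D) :=
  \matrix_(a, b) (tens_idx a == [ffun l => tens_idx b (s l)])%:R.

Definition omega (R : realType) (d : nat) : R[i] :=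
  cos (2 * pi / d%:R) +i* sin (2 * pi / d%:R).

(* Z_d is represented by 'I_d: its elements only occur as basis labels and as
   exponents of [omega] and [Zop], both of order d. *)
Definition Zop (R : realType) (d : nat) : 'M[R[i]]_d :=
  diag_mx (\row_(j < d) omega R d ^+ j).

Definition ket_plus (R : realType) (d : nat) : 'cV[R[i]]_d :=
  const_mx ((Num.sqrt d%:R)^-1)%:C.

Definition CZ (R : realType) (n d : nat) (e : 'I_n * 'I_n) :
    'M[R[i]]_(tensdim n d) :=
  \sum_(k < d) tens_op (fun l => if l == e.1 then delta_mx k k
                                 else if l == e.2 then Zop R d ^+ k
                                 else 1%:M).

(* An undirected graph on 'I_n without loops: the edge {i, j} with i < j is
   recorded as the pair (i, j). *)
Definition edge_set (n : nat) (E : {set 'I_n * 'I_n}) : Prop :=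
  forall e, e \in E -> (e.1 < e.2)%N.

(* The factors of the product commute, so their order is irrelevant. *)
Definition graph_state (R : realType) (n d : nat) (E : {set 'I_n * 'I_n})
    (m : 'I_n * 'I_n -> 'I_d) : 'cV[R[i]]_(tensdim n d) :=
  (\prod_(e in E) CZ R d e ^+ m e) *m tens_ket (fun _ => ket_plus R d).

Definition ket_proj (R : realType) (D : nat) (v : 'cV[R[i]]_D) : 'M[R[i]]_D :=
  v *m v^t*.

Definition strategy (R : realType) (D : nat) (G : 'cV[R[i]]_D) (lambda : R) :
    'M[R[i]]_D :=
  ket_proj G + lambda%:C *: (1%:M - ket_proj G).

Definition co_strategy (R : realType) (D : nat) (G : 'cV[R[i]]_D) (lambda : R) :
    'M[R[i]]_D :=
  1%:M - strategy G lambda.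

(* In the order of R[i], 0 <= z means that z is a nonnegative real; hence the
   first conjunct also entails that rho is Hermitian. *)
Definition density_op (R : realType) (D : nat) (rho : 'M[R[i]]_D) : Prop :=
  (forall v : 'cV[R[i]]_D, 0 <= (v^t* *m rho *m v) ord0 ord0) /\ \tr rho = 1.

Definition perm_invariant (R : realType) (n D : nat)
    (rho : 'M[R[i]]_(tensdim n D)) : Prop :=
  forall s : 'S_n, perm_op R[i] D s *m rho *m (perm_op R[i] D s)^t* = rho.

(* Omega^{(x) (N - i)} (x) (1 - Omega)^{(x) i} (x) X, for i <= N. *)
Definition test_op (R : realType) (D : nat) (G : 'cV[R[i]]_D) (lambda : R)
    (N i : nat) (X : 'M[R[i]]_D) : 'M[R[i]]_(tensdim N.+1 D) :=
  tens_op (fun l : 'I_N.+1 => if (l < N - i)%N then strategy G lambda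
                              else if (l < N)%N then co_strategy G lambda
                              else X).

(* The traces below are real when rho is a density operator; [complex.Re]
   only changes their type. *)
Definition pass_prob (R : realType) (D : nat) (G : 'cV[R[i]]_D) (lambda : R)
    (k N : nat) (rho : 'M[R[i]]_(tensdim N.+1 D)) : R :=
  \sum_(i < k.+1) 'C(N, i)%:R *
    complex.Re (\tr (test_op G lambda N i 1%:M *m rho)).

Definition pass_fid (R : realType) (D : nat) (G : 'cV[R[i]]_D) (lambda : R)
    (k N : nat) (rho : 'M[R[i]]_(tensdim N.+1 D)) : R :=
  \sum_(i < k.+1) 'C(N, i)%:R *
    complex.Re (\tr (test_op G lambda N i (ket_proj G) *m rho)).

Definition cond_fidelity (R : realType) (D : nat) (G : 'cV[R[i]]_D) (lambda : R)
    (k N : nat) (rho : 'M[R[i]]_(tensdim N.+1 D)) : R :=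
  pass_fid G lambda k rho / pass_prob G lambda k rho.

Definition feasible_fidelities (R : realType) (D : nat) (G : 'cV[R[i]]_D)
    (lambda : R) (k N : nat) (delta : R) : set R :=
  [set F | exists rho : 'M[R[i]]_(tensdim N.+1 D),
     [/\ density_op rho, perm_invariant rho,
         delta <= pass_prob G lambda k rho
       & F = cond_fidelity G lambda k rho] ]%classic.

(* For 0 < delta <= 1 the infimum is a minimum: the feasible density operators
   form a nonempty compact set, on which the fidelity is continuous. *)
Definition guaranteed_infidelity (R : realType) (D : nat) (G : 'cV[R[i]]_D)
    (lambda : R) (k N : nat) (delta : R) : R :=
  1 - inf (feasible_fidelities G lambda k N delta).

(* Main.v *)
(* Diagonalise the tests: with P = |G><G| and Q = 1 - P, both Omega = P + lambda Q
   and 1 - Omega = nu Q are combinations of P and Q, so a permutation-invariant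
   rho only matters through the probabilities w_z that z of its N + 1 systems are
   in the range of Q. Writing B_z for the probability that z independent coins of
   bias nu give at most k failures, one finds
     (N + 1) (p - f) = sum_z w_z z B_(z-1)   and   p >= sum_z w_z B_z.
   Soundness follows from a linear bound z B_(z-1) <= a B_z + (T - a) delta valid
   for all z, where T = eps (N + 1). Since lambda z B_(z-1) is the expected number
   of passes of z tests on the event of at most k failures, this is a bound on an
   expectation truncated to that event, which an exponential tilt making
   exp (v passes - u failures) a martingale estimates uniformly in z. The optimal
   tilt is exp (- (u + v)) = (lambda sqrt (2 nu) + r) / (lambda sqrt (2 nu) + 1).
   Robustness is the Chernoff bound for the upper tail of a binomial law. *)
Require Import Defs.
From mathcomp Require Import all_boot all_order all_fingroup all_algebra.
From mathcomp Require Import spectral complex ring lra zify.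
From mathcomp Require Import boolp classical_sets functions reals.
From mathcomp Require Import topology normedtype derive sequences exp trigo.

Set Implicit Arguments.
Unset Strict Implicit.
Unset Printing Implicit Defensive.

Import Order.TTheory GRing.Theory Num.Theory.
Import numFieldNormedType.Exports.
Local Open Scope ring_scope.
Local Open Scope complex_scope.
Local Open Scope sesquilinear_scope.

(** * Logarithm and binomial estimates *)

Lemma ge0_deriv_le (R : realType) (f df : R -> R) (a b : R) : a <= b ->
  (forall x, x \in `[a, b] -> is_derive x 1 f (df x)) ->
  (forall x, x \in `[a, b] -> 0 <= df x) -> f a <= f b.
Proof.
move=> ab fd df0.
have fc : {within `[a, b]%classic, continuous f}%classic.
  apply: derivable_within_continuous => x xab.
  by have [] := fd x xab.
have [x xab E] := MVT_segment ab (fun x xab => fd x (subset_itv_oo_cc xab)) fc.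
by rewrite -subr_ge0 E mulr_ge0 ?subr_ge0 ?df0.
Qed.

(** The difference of the two sides vanishes at 0 and has derivative [y ^+ 2 / (1 - y)], which is
    nonnegative. *)
Lemma ln_le_taylor2 (R : realType) (x : R) :
  0 <= x < 1 -> ln (1 - x) <= - x - x ^+ 2 / 2.
Proof.
move=> /andP[x0 x1].
pose f (y : R) := - ln (1 - y) - y - y ^+ 2 / 2.
pose df (y : R) := (1 - y)^-1 - 1 - y.
suff : f 0 <= f x by rewrite /f (subr0 (1 : R)) ln1; lra.
apply: (@ge0_deriv_le _ f df) => // y; rewrite in_itv /= => /andP[y0 yx].
- have y1 : 0 < 1 - y by lra.
  have := is_derive1_ln y1 => dl.
  have -> : f = (- (ln (R:=R) \o (cst 1 - id)) - id) - (2^-1 \*: (id ^+ 2)).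
    by apply/funext => t; rewrite /f /= !fctE /= mulrC.
  apply: is_derive_eq; rewrite /df /GRing.scale/=; field; lra.
- have y1 : 0 < 1 - y by lra.
  have -> : df y = y ^+ 2 / (1 - y) by rewrite /df; field; lra.
  by rewrite divr_ge0 ?sqr_ge0 ?ltW.
Qed.

(** Multiplying by [x] clears the inverse; the difference then has derivative [y - ln y - 1],
    nonnegative by the tangent bound for [ln]. *)
Lemma ln_le_half_subV (R : realType) (x : R) :
  1 <= x -> ln x <= (x - x^-1) / 2.
Proof.
move=> x1.
pose f (y : R) := y ^+ 2 / 2 - y * ln y.
pose df (y : R) := y - ln y - 1.
have x0 : 0 < x by lra.
suff : f 1 <= f x.
  rewrite /f ln1 => fx; rewrite -(ler_pM2l x0).
  have -> : x * ((x - x^-1) / 2) = (x ^+ 2 - 1) / 2 by field; lra.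
  by lra.
apply: (@ge0_deriv_le _ f df) => // y; rewrite in_itv /= => /andP[y1 yx].
- have y0 : 0 < y by lra.
  have := is_derive1_ln y0 => dl.
  have -> : f = 2^-1 \*: (id ^+ 2) - id * ln (R:=R).
    by apply/funext => t; rewrite /f /= !fctE /= mulrC.
  apply: is_derive_eq; rewrite /df /GRing.scale/=; field; lra.
- have /le_ln1Dx : -1 < y - 1 by lra.
  have -> : 1 + (y - 1) = y by ring.
  by rewrite /df; lra.
Qed.

Lemma binom_sum (R : realType) (N : nat) (x y : R) :
  \sum_(j < N.+1) 'C(N, j)%:R * x ^+ j * y ^+ (N - j) = (x + y) ^+ N.
Proof.
rewrite addrC exprDn; apply: eq_bigr => i _.
by rewrite -[in RHS]mulr_natl mulrA mulrAC.
Qed.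

(** Both sums are padded with zeros to length [maxn k N], so neither range has to contain the
    other. *)
Lemma ler_sum_support (R : numDomainType) (k N : nat) (F G : nat -> R) :
  (forall j, 0 <= G j) -> (forall j, (j < k)%N -> (j < N)%N -> F j <= G j) ->
  (forall j, (N <= j)%N -> F j = 0) ->
  \sum_(j < k) F j <= \sum_(j < N) G j.
Proof.
move=> G0 FG F0.
pose H j := if (j < N)%N then G j else 0.
have -> : \sum_(j < N) G j = \sum_(j < maxn k N) H j.
  rewrite (big_ord_widen _ G (leq_maxr k N)) big_mkcond; exact: eq_bigr.
rewrite (big_ord_widen _ F (leq_maxl k N)) big_mkcond.
apply: ler_sum => j _; rewrite /H.
case: (ltnP j N) => jN; case: ltnP => jk //=; first exact: FG.
by rewrite F0.
Qed.

(** Condition on the last coin: the bound is lost exactly when the first [z] coins show [k] failures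
    and the last one fails too. *)
Lemma binom_cdf_succ (R : realType) (z k : nat) (p : R) :
  binom_cdf z.+1 k p
  = binom_cdf z k p - p * ('C(z, k)%:R * p ^+ k * (1 - p) ^+ (z - k)).
Proof.
elim: k => [|k IH]; first by rewrite /binom_cdf !big_ord1 !bin0 !subn0 exprS; ring.
rewrite /binom_cdf big_ord_recr [in RHS]big_ord_recr /=.
rewrite -/(binom_cdf z.+1 k p) -/(binom_cdf z k p) IH binS natrD subSS.
have E : 'C(z, k.+1)%:R * p ^+ k.+1 * (1 - p) ^+ (z - k)
  = (1 - p) * ('C(z, k.+1)%:R * p ^+ k.+1 * (1 - p) ^+ (z - k.+1)) :> R.
  case: (ltnP k z) => kz; last by rewrite bin_small ?ltnS// !mul0r mulr0.
  by rewrite -[in LHS](subnSK kz) [X in _ * X]exprS; ring.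
rewrite !mulrDl E exprS; ring.
Qed.

Lemma binom_cdf_succ_le (R : realType) (z k : nat) (p : R) : 0 <= p <= 1 ->
  binom_cdf z.+1 k p <= binom_cdf z k p.
Proof.
move=> /andP[p0 p1]; rewrite binom_cdf_succ lerBlDr lerDl.
by rewrite !mulr_ge0 ?exprn_ge0 ?subr_ge0.
Qed.

(** Both sides are the expected number of passes among [z] coins on the event of at most [k]
    failures: once a given coin passes, the other [z - 1] carry the event. At [z = 0] the factor [z]
    kills the default value of [z.-1]. *)
Lemma mul_binom_cdf_pred (R : realType) (z k : nat) (p : R) :
  (1 - p) * z%:R * binom_cdf z.-1 k p =
  \sum_(j < k.+1) (z%:R - j%:R) * ('C(z, j)%:R * p ^+ j * (1 - p) ^+ (z - j)).
Proof.
case: z => [|z] /=.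
  rewrite mulr0 mul0r big1// => -[[|j] jk] _ /=; first by rewrite subrr mul0r.
  by rewrite bin0n !mul0r mulr0.
rewrite /binom_cdf big_distrr; apply: eq_bigr => -[j jk] _ /=.
case: (ltnP z j) => zj.
  rewrite bin_small// !mul0r mulr0.
  move: zj; rewrite leq_eqVlt => /orP[/eqP <-|zj]; first by rewrite subrr mul0r.
  by rewrite bin_small// !mul0r mulr0.
have E : (z.+1%:R - j%:R) * 'C(z.+1, j)%:R = z.+1%:R * 'C(z, j)%:R :> R.
  by rewrite -natrB ?leqW// -!natrM mul_bin_down.
rewrite subSn// exprS.
transitivity (((z.+1%:R - j%:R) * 'C(z.+1, j)%:R) * p ^+ j
  * ((1 - p) * (1 - p) ^+ (z - j))); first by rewrite E; ring.
ring.
Qed.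

(* For j <= k the factor z - j - c is at most exp (v (z - j - c) - 1) / v, hence at
   most that times exp (u (k - j)); the relation between u and v makes the
   expectation of this majorant independent of z. *)
Lemma binom_truncated_le (R : realType) (nu u v c : R) (z k : nat) :
  0 <= nu <= 1 -> 0 <= u -> 0 < v ->
  nu * expR (- u) + (1 - nu) * expR v = 1 ->
  \sum_(j < k.+1) (z%:R - j%:R - c)
     * ('C(z, j)%:R * nu ^+ j * (1 - nu) ^+ (z - j))
  <= v^-1 * expR (u * k%:R - v * c - 1).
Proof.
move=> /andP[nu0 nu1] u0 v0 E.
pose G j := v^-1 * expR (u * k%:R - v * c - 1)
  * ('C(z, j)%:R * (nu * expR (- u)) ^+ j * ((1 - nu) * expR v) ^+ (z - j)).
have p0 : 0 <= 1 - nu by rewrite subr_ge0.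
have := @ler_sum_support R k.+1 z.+1 (fun j => (z%:R - j%:R - c)
     * ('C(z, j)%:R * nu ^+ j * (1 - nu) ^+ (z - j))) G.
rewrite -(big_distrr (v^-1 * expR _)) /= binom_sum E expr1n mulr1; apply.
- move=> j; rewrite /G.
  by rewrite !mulr_ge0 ?invr_ge0 ?exprn_ge0 ?mulr_ge0 ?expR_ge0// ltW.
- move=> j jk jz /=.
  have -> : G j = v^-1 * expR (v * (z%:R - j%:R - c) - 1) * expR (u * (k%:R - j%:R))
     * ('C(z, j)%:R * nu ^+ j * (1 - nu) ^+ (z - j)).
    rewrite /G !exprMn -!expRM_natl natrB//.
    have -> : u * k%:R - v * c - 1 =
      (v * (z%:R - j%:R - c) - 1) + u * (k%:R - j%:R) + j%:R * u - (z%:R - j%:R) * v by ring.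
    rewrite (mulrN j%:R) !expRD !expRN -!mulrA.
    have := expR_gt0 (j%:R * u); have := expR_gt0 ((z%:R - j%:R) * v).
    move: (expR _) => x; move: (expR (j%:R * _)) => y x0 y0.
    by field; rewrite !gt_eqF ?expR_gt0.
  apply: ler_wpM2r => /=; first by rewrite !mulr_ge0 ?exprn_ge0.
  apply: le_trans (_ : v^-1 * expR (v * (z%:R - j%:R - c) - 1) <= _).
    rewrite -ler_pdivrMl ?invr_gt0// invrK.
    by apply: le_trans (expR_ge1Dx _); rewrite [leRHS]addrC subrK.
  rewrite ler_peMr ?mulr_ge0 ?invr_ge0 ?expR_ge0 ?(ltW v0)//.
  by rewrite -[leLHS]expR0 ler_expR mulr_ge0 ?subr_ge0 ?ler_nat//.
- by move=> j zj; rewrite bin_small// !mul0r mulr0.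
Qed.

(** The right side is the decay rate per unit of [T] in [truncated_gap]. Bounding both logarithms to
    second order, the terms linear in [1 - s] cancel, and the quadratic ones add up because the
    factors [lambda] and [1 - lambda] sum to 1. *)
Lemma rate_ge (R : realType) (lambda s : R) : 0 < lambda < 1 -> 0 < s < 1 ->
  lambda * (1 - lambda) * (1 - s) ^+ 2 / 2
  <= lambda * - ln (lambda + (1 - lambda) * s)
     - s * (1 - lambda) * ln ((lambda + (1 - lambda) * s) / s).
Proof.
move=> /andP[l0 l1] /andP[s0 s1].
set b := lambda + _.
have bE : b = 1 - (1 - lambda) * (1 - s) by rewrite /b; ring.
have nu0 : 0 < (1 - lambda) * (1 - s) by rewrite mulr_gt0; lra.
have nu1 : (1 - lambda) * (1 - s) < 1.
  by rewrite -[ltRHS]mulr1 ltr_pM//; lra.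
have b0 : 0 < b by lra.
have bs : s <= b.
  rewrite -subr_ge0; have -> : b - s = lambda * (1 - s) by rewrite /b; ring.
  by rewrite mulr_ge0; lra.
have h1 : lambda * ((1 - lambda) * (1 - s) + ((1 - lambda) * (1 - s)) ^+ 2 / 2)
    <= lambda * - ln b.
  rewrite ler_pM2l// bE.
  by have /ln_le_taylor2 : 0 <= (1 - lambda) * (1 - s) < 1 by [lra]; lra.
have h2 : s * (1 - lambda) * ln (b / s)
    <= (1 - lambda) * lambda * (1 - s) - (1 - lambda) * lambda ^+ 2 * (1 - s) ^+ 2 / 2.
  apply: le_trans (_ : s * (1 - lambda) * ((b / s - (b / s)^-1) / 2) <= _).
    rewrite ler_pM2l; last by rewrite mulr_gt0; lra.
    by rewrite ln_le_half_subV// ler_pdivlMr// mul1r.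
  have -> : s * (1 - lambda) * ((b / s - (b / s)^-1) / 2)
     = (1 - lambda) * lambda * (1 - s)
       - (1 - lambda) * lambda ^+ 2 * (1 - s) ^+ 2 / 2 / b.
    by rewrite /b in b0 *; field; lra.
  rewrite lerD2l lerN2 ler_pdivlMr// ler_piMr//; last by lra.
  by rewrite divr_ge0// !mulr_ge0 ?sqr_ge0//; lra.
apply: le_trans (lerB h1 h2); rewrite le_eqVlt; apply/orP; left.
by apply/eqP; field.
Qed.

(* The slope is a = T - 1 / (lambda v), where v is the tilt given by
   exp (- v) = lambda + (1 - lambda) s. *)
Lemma truncated_gap (R : realType) (lambda s T delta : R) (k : nat) :
  0 < lambda < 1 -> 0 < s < 1 -> 0 < delta <= 1 / 2 ->
  k%:R <= s * (1 - lambda) * T ->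
  ln delta^-1 <= (lambda * (1 - lambda) * (1 - s)) ^+ 2 * T ->
  exists2 a, 0 <= a <= T & forall z, z%:R * binom_cdf z.-1 k (1 - lambda)
    <= a * binom_cdf z k (1 - lambda) + (T - a) * delta.
Proof.
move=> l01 s01 /andP[d0 d1] kT LT.
have rate := rate_ge l01 s01.
case/andP: (l01) => l0 l1; case/andP: (s01) => s0 s1.
set b := lambda + _ in rate.
have bE : b = 1 - (1 - lambda) * (1 - s) by rewrite /b; ring.
have nu0 : 0 < (1 - lambda) * (1 - s) by rewrite mulr_gt0; lra.
have nu1 : (1 - lambda) * (1 - s) < 1.
  by rewrite -[ltRHS]mulr1 ltr_pM//; lra.
have b0 : 0 < b by lra.
have bs : s <= b.
  rewrite -subr_ge0; have -> : b - s = lambda * (1 - s) by rewrite /b; ring.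
  by rewrite mulr_ge0; lra.
set v := - ln b in rate; set u := ln (b / s) in rate.
have v0 : 0 < v by rewrite /v oppr_gt0 ln_lt0//; lra.
have u0 : 0 <= u by rewrite /u ln_ge0// ler_pdivlMr// mul1r.
have lv0 : 0 < lambda * v by rewrite mulr_gt0.
(* Here [delta <= 1 / 2 <= exp (- 1 / 2)]. With the factor 2 in [expo] this yields
   [lambda * v * T >= 1], that is, a nonnegative slope. *)
have half : 1 / 2 <= ln delta^-1.
  rewrite lnV ?posrE// lerNr -ler_expR lnK ?posrE//.
  by apply: le_trans d1 _; apply: le_trans (expR_ge1Dx _); lra.
have sq0 : 0 <= (lambda * (1 - lambda) * (1 - s)) ^+ 2 by exact: sqr_ge0.
have T0 : 0 <= T.
  rewrite leNgt; apply/negP => T0.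
  by have := mulr_ge0_le0 sq0 (ltW T0); lra.
(* The factor 2 is available because [1 - 4 * lambda * (1 - lambda)] is the square of
   [1 - 2 * lambda]. *)
have expo : 2 * ln delta^-1 <= lambda * v * T - u * k%:R.
  apply: le_trans (_ : (lambda * v - s * (1 - lambda) * u) * T <= _); last first.
    rewrite mulrBl lerD2l lerN2 mulrAC [leRHS]mulrC.
    by rewrite ler_wpM2l.
  apply: le_trans (_ : lambda * (1 - lambda) * (1 - s) ^+ 2 / 2 * T <= _); last first.
    by rewrite ler_wpM2r.
  apply: le_trans (_ : 2 * ((lambda * (1 - lambda) * (1 - s)) ^+ 2 * T) <= _).
    by rewrite ler_pM2l.
  rewrite mulrA ler_wpM2r// -subr_ge0.
  have -> : lambda * (1 - lambda) * (1 - s) ^+ 2 / 2 -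
     2 * (lambda * (1 - lambda) * (1 - s)) ^+ 2
    = lambda * (1 - lambda) * (1 - s) ^+ 2 / 2 * (1 - 2 * lambda) ^+ 2 by field.
  by apply: mulr_ge0 (sqr_ge0 _); rewrite !mulr_ge0//; lra.
have uk0 : 0 <= u * k%:R by rewrite mulr_ge0.
exists (T - (lambda * v)^-1).
  rewrite gerBl invr_ge0 (ltW lv0) andbT subr_ge0.
  by rewrite -[leLHS]mul1r ler_pdivrMr//; lra.
move=> z; rewrite [T - (T - _)]subKr -lerBlDl.
rewrite -(ler_pM2l l0).
have E : (1 - lambda) * expR (- u) + (1 - (1 - lambda)) * expR v = 1.
  rewrite /u /v ln_div ?posrE// opprB expRD !expRN !lnK ?posrE//.
  by rewrite -[RHS](divff (lt0r_neq0 b0)) {3}/b; ring.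
have nu01 : 0 <= 1 - lambda <= 1 by lra.
(* The shift [c] is [lambda] times the slope, so [v * c = lambda * v * T - 1] and the units in the
   exponent cancel. *)
have := @binom_truncated_le R (1 - lambda) u v (lambda * (T - (lambda * v)^-1)) z k nu01 u0 v0 E.
under eq_bigr do rewrite mulrBl.
rewrite sumrB -mul_binom_cdf_pred -big_distrr /= -/(binom_cdf z k (1 - lambda)).
have -> : v * (lambda * (T - (lambda * v)^-1)) = lambda * v * T - 1.
  by field; rewrite !gt_eqF.
have -> : u * k%:R - (lambda * v * T - 1) - 1 = u * k%:R - lambda * v * T by ring.
have -> : lambda * ((lambda * v)^-1 * delta) = v^-1 * delta.
  by field; rewrite !gt_eqF.
move=> H; apply: le_trans (_ : v^-1 * expR (u * k%:R - lambda * v * T) <= _).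
  apply: le_trans H; rewrite le_eqVlt; apply/orP; left; apply/eqP; ring.
rewrite ler_pM2l ?invr_gt0//.
rewrite -[leRHS]lnK ?posrE// ler_expR.
by move: expo half; rewrite lnV ?posrE//; lra.
Qed.

(** Exponential Markov inequality: outcomes [j > k] get weight [exp (t (j - k - 1)) >= 1], and the
    moment generating function is bounded by that of the Poisson law of the same mean. *)
Lemma binom_cdf_chernoff (R : realType) (N k : nat) (p t : R) :
  0 <= p <= 1 -> 0 <= t ->
  1 - binom_cdf N k p <= expR (N%:R * p * (expR t - 1) - t * k.+1%:R).
Proof.
move=> /andP[p0 p1] t0.
pose b j := 'C(N, j)%:R * p ^+ j * (1 - p) ^+ (N - j).
have b0 j : 0 <= b j by rewrite !mulr_ge0 ?exprn_ge0 ?subr_ge0.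
pose F j := if (j < k.+1)%N then b j else 0.
have h1 : \sum_(j < N.+1) F j <= binom_cdf N k p.
  apply: (@ler_sum_support _ N.+1 k.+1 F b) => // j; rewrite /F; first by move=> _ ->.
  by move=> kj; rewrite ifN // -leqNgt.
have h2 : 1 <= \sum_(j < N.+1) F j + \sum_(j < N.+1) expR (- t * k.+1%:R)
    * ('C(N, j)%:R * (p * expR t) ^+ j * (1 - p) ^+ (N - j)).
  rewrite -big_split /=.
  have {1}-> : 1 = \sum_(j < N.+1) b j.
    by rewrite /b binom_sum addrC subrK expr1n.
  apply: ler_sum => j _; rewrite /F.
  have -> : expR (- t * k.+1%:R) * ('C(N, j)%:R * (p * expR t) ^+ j * (1 - p) ^+ (N - j))
     = expR (t * (j%:R - k.+1%:R)) * b j.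
    rewrite exprMn -expRM_natl /b.
    have -> : t * (j%:R - k.+1%:R) = - t * k.+1%:R + j%:R * t by ring.
    by rewrite expRD; ring.
  case: ltnP => jk; first by rewrite lerDl mulr_ge0 ?expR_ge0.
  rewrite add0r ler_peMl// -[leLHS]expR0 ler_expR mulr_ge0// subr_ge0 ler_nat//.
move: h2; rewrite -big_distrr /= binom_sum => h2.
rewrite lerBlDr addrC; apply: le_trans h2 _; apply: lerD => //.
rewrite addrC expRD mulrC -mulNr.
apply: ler_pM; rewrite ?expR_ge0 ?exprn_ge0//.
  by rewrite addr_ge0 ?mulr_ge0 ?expR_ge0 ?subr_ge0.
rewrite -mulrA expRM_natl lerXn2r ?nnegrE ?expR_ge0//.
  by rewrite addr_ge0 ?mulr_ge0 ?expR_ge0 ?subr_ge0.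
by apply: le_trans (expR_ge1Dx _); lra.
Qed.

(** The mean is [r * G] and the threshold [s * G], for which [ln (s / r)] is the optimal Poisson
    tilt. That tilt requires [0 < r], hence the separate case [p = 0]. *)
Lemma binom_cdf_poisson_tail (R : realType) (N k : nat) (p r s G delta : R) :
  0 <= p <= 1 -> 0 < delta -> 0 <= r < s -> s <= 1 -> 0 <= G ->
  N%:R * p = r * G -> p = 0 \/ 0 < r -> s * G <= k.+1%:R ->
  ln delta^-1 <= G * (s - r) ^+ 2 / 2 ->
  1 - delta <= binom_cdf N k p.
Proof.
move=> p01 d0 /andP[r0 rs] s1 G0 Np [-> | {}r0] kG LG.
  rewrite /binom_cdf big_ord_recl big1 => [|j _].
    by rewrite bin0 !expr0 subr0 expr1n; lra.
  by rewrite expr0n mulr0 mul0r.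
have s0 : 0 < s by lra.
have t0 : 0 <= ln (s / r) by rewrite ln_ge0// ler_pdivlMr// mul1r ltW.
rewrite lerBlDr addrC -lerBlDr.
apply: le_trans (binom_cdf_chernoff N k p01 t0) _.
rewrite lnK ?posrE ?divr_gt0// Np -[leRHS]lnK ?posrE// ler_expR.
have lnd : ln delta^-1 = - ln delta by rewrite lnV.
(* This is [ln_le_taylor2] at [1 - r / s]; the bound [s <= 1] removes the remaining denominator. *)
have h1 : s * ((s - r) + (s - r) ^+ 2 / 2) <= s * (s * ln (s / r)).
  rewrite ler_pM2l//.
  have sr : s * ln (s / r) = - s * ln (1 - (1 - r / s)).
    by rewrite subKr !ln_div ?posrE//; ring.
  have y01 : 0 <= 1 - r / s < 1.
    by rewrite subr_ge0 ler_pdivrMr// mul1r (ltW rs)/= gtrBl divr_gt0.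
  rewrite sr mulNr lerNr.
  apply: le_trans (_ : s * (- (1 - r / s) - (1 - r / s) ^+ 2 / 2) <= _).
    by rewrite ler_pM2l// ln_le_taylor2.
  have -> : s * (- (1 - r / s) - (1 - r / s) ^+ 2 / 2)
    = - ((s - r) + (s - r) ^+ 2 / 2 / s) by field; lra.
  rewrite lerN2 lerD2l ler_pdivlMr// ler_piMr ?divr_ge0 ?sqr_ge0//.
rewrite ler_pM2l// in h1.
have h2 : ln (s / r) * (s * G) <= ln (s / r) * k.+1%:R by rewrite ler_wpM2l.
have h3 := ler_wpM2r G0 h1.
have -> : r * G * (s / r - 1) = (s - r) * G by field; lra.
by lra.
Qed.

(** * Tensor powers and graph states *)

Lemma tens_idx_bij (n D : nat) : bijective (@tens_idx n D).
Proof. exact: enum_val_bij. Qed.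

Lemma big_tens_idx (R : Type) (idx : R) (op : Monoid.com_law idx) (n D : nat)
    (F : {ffun 'I_n -> 'I_D} -> R) :
  \big[op/idx]_(a < tensdim n D) F (tens_idx a) = \big[op/idx]_f F f.
Proof. by rewrite [RHS](reindex (@tens_idx n D))//; apply/onW_bij/tens_idx_bij. Qed.

Lemma tens_idx_neq (n D : nat) (a b : 'I_(tensdim n D)) :
  a != b -> exists l, tens_idx a l != tens_idx b l.
Proof.
move=> ab; apply/existsP; apply: contraNT ab => /existsPn h.
apply/eqP/(bij_inj (tens_idx_bij n D))/ffunP => l.
by apply/eqP; move: (h l); rewrite negbK.
Qed.

Lemma tens_opM (C : comPzRingType) (n D : nat) (A B : 'I_n -> 'M[C]_D) :
  tens_op A *m tens_op B = tens_op (fun l => A l *m B l).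
Proof.
apply/matrixP => a c; rewrite !mxE.
under eq_bigr do rewrite !mxE -big_split.
rewrite (big_tens_idx _ (fun f => \prod_(l < n)
  (A l (tens_idx a l) (f l) * B l (f l) (tens_idx c l)))).
rewrite -(bigA_distr_bigA (fun l i => A l (tens_idx a l) i * B l i (tens_idx c l))).
by apply: eq_bigr => l _; rewrite mxE.
Qed.

Lemma tens_op1 (C : comPzRingType) (n D : nat) :
  tens_op (fun _ : 'I_n => 1%:M : 'M[C]_D) = 1%:M.
Proof.
apply/matrixP => a b; rewrite !mxE; have [->|ab] := eqVneq a b.
  by rewrite big1// => l _; rewrite mxE eqxx.
have [l lab] := tens_idx_neq ab.
by rewrite (bigD1 l)//= mxE (negPf lab) mul0r.
Qed.

Lemma tens_op_sum (C : comPzRingType) (I : finType) (n D : nat)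
    (F : 'I_n -> I -> 'M[C]_D) :
  tens_op (fun l => \sum_i F l i)
  = \sum_(c : {ffun 'I_n -> I}) tens_op (fun l => F l (c l)).
Proof.
apply/matrixP => a b; rewrite summxE mxE.
under eq_bigr do rewrite summxE.
by rewrite bigA_distr_bigA; apply: eq_bigr => c _; rewrite mxE.
Qed.

Lemma tens_opZ (C : comPzRingType) (n D : nat) (x : 'I_n -> C)
    (A : 'I_n -> 'M[C]_D) :
  tens_op (fun l => x l *: A l) = (\prod_l x l) *: tens_op A.
Proof.
apply/matrixP => a b; rewrite !mxE -big_split.
by apply: eq_bigr => l _; rewrite mxE.
Qed.

Lemma mxtrace_tens_op (C : comPzRingType) (n D : nat) (A : 'I_n -> 'M[C]_D) :
  \tr (tens_op A) = \prod_l \tr (A l).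
Proof.
rewrite /mxtrace bigA_distr_bigA.
under eq_bigr do rewrite mxE.
exact: (big_tens_idx _ (fun f => \prod_(l < n) A l (f l) (f l))).
Qed.

Lemma tens_op_adj (R : realType) (n D : nat) (A : 'I_n -> 'M[R[i]]_D) :
  (tens_op A)^t* = tens_op (fun l => (A l)^t*).
Proof.
apply/matrixP => a b; rewrite !mxE rmorph_prod.
by apply: eq_bigr => l _; rewrite !mxE.
Qed.

(** Read by rows, the matrix has a single nonzero column per row, so sums over the column index
    collapse. *)
Lemma perm_opE (C : comPzRingType) (n D : nat) (s : 'S_n)
    (a b : 'I_(tensdim n D)) :
  perm_op C D s a b = (tens_idx b == [ffun l => tens_idx a (s^-1%g l)])%:R.
Proof.
rewrite mxE; congr (nat_of_bool _)%:R; apply/eqP/eqP => ->.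
  by apply/ffunP => l; rewrite !ffunE permKV.
by apply/ffunP => l; rewrite !ffunE permK.
Qed.

Lemma perm_op_conj (R : realType) (n D : nat) (s : 'S_n)
    (A : 'I_n -> 'M[R[i]]_D) :
  perm_op R[i] D s *m tens_op A *m (perm_op R[i] D s)^t*
  = tens_op (fun l => A (s l)).
Proof.
pose M f g := \prod_l A l (f l) (g l).
pose sh a := [ffun l => @tens_idx n D a (s^-1%g l)].
have lE a b : (perm_op R[i] D s *m tens_op A) a b = M (sh a) (tens_idx b).
  rewrite mxE; under eq_bigr do rewrite perm_opE mxE.
  rewrite (big_tens_idx _ (fun f => (f == sh a)%:R * M f (tens_idx b))).
  rewrite (bigD1 (sh a))//= eqxx mul1r big1 ?addr0// => f /negPf ->.
  by rewrite mul0r.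
apply/matrixP => a c; rewrite mxE.
under eq_bigr => b do rewrite lE mxE mxE perm_opE rmorph_nat.
rewrite (big_tens_idx _ (fun f => M (sh a) f * (f == sh c)%:R)).
rewrite (bigD1 (sh c))//= eqxx mulr1 big1 ?addr0; last first.
  by move=> f /negPf ->; rewrite mulr0.
rewrite mxE /M (reindex_inj (@perm_inj _ s)).
by apply: eq_bigr => l _; rewrite !ffunE permK.
Qed.

(** Diagonal unitaries: they preserve the modulus of every amplitude, and products of CZ gates stay
    among them. *)
Definition unit_diag (R : realType) (D : nat) (U : 'M[R[i]]_D) : Prop :=
  exists2 v : 'rV[R[i]]_D, U = diag_mx v & forall j, `|v ord0 j| = 1.

Lemma unit_diag1 (R : realType) (D : nat) : unit_diag (1 : 'M[R[i]]_D).
Proof.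
exists (const_mx 1); first by rewrite diag_const_mx.
by move=> j; rewrite mxE normr1.
Qed.

Lemma unit_diagM (R : realType) (D : nat) (U V : 'M[R[i]]_D) :
  unit_diag U -> unit_diag V -> unit_diag (U * V).
Proof.
move=> [u -> hu] [v -> hv]; exists (\row_j (u ord0 j * v ord0 j)).
  by rewrite -mulmx_diag.
by move=> j; rewrite mxE normrM hu hv mulr1.
Qed.

Lemma unit_diagX (R : realType) (D : nat) (U : 'M[R[i]]_D) k :
  unit_diag U -> unit_diag (U ^+ k).
Proof.
move=> hU; elim: k => [|k IH]; first by rewrite expr0; exact: unit_diag1.
by rewrite exprS; exact: unit_diagM.
Qed.

Lemma norm_omega (R : realType) (d : nat) : `|omega R d| = 1.
Proof. by rewrite normc_def /= cos2Dsin2 sqrtr1. Qed.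

Lemma ZopX (R : realType) (d k : nat) :
  Zop R d ^+ k = diag_mx (\row_(j < d) omega R d ^+ (j * k)).
Proof.
elim: k => [|k IH].
  rewrite expr0 -[LHS]diag_const_mx; congr diag_mx.
  by apply/rowP => j; rewrite !mxE muln0.
rewrite exprS IH /Zop -[LHS]/(_ *m _) mulmx_diag; congr diag_mx.
by apply/rowP => j; rewrite !mxE mulnS exprD.
Qed.

Lemma tens_op_diag (C : comPzRingType) (n D : nat) (v : 'I_n -> 'rV[C]_D) :
  tens_op (fun l => diag_mx (v l))
  = diag_mx (\row_a \prod_l v l ord0 (tens_idx a l)).
Proof.
apply/matrixP => a b; rewrite !mxE; have [->|ab] := eqVneq a b.
  by rewrite mulr1n; apply: eq_bigr => l _; rewrite mxE eqxx mulr1n.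
have [l lab] := tens_idx_neq ab.
by rewrite (bigD1 l)//= mxE (negPf lab) /= mul0r.
Qed.

(** On the basis vector [a] only the summand [k = a e.1] survives, which leaves the phase
    [omega ^+ (a e.1 * a e.2)]. *)
Lemma CZ_unit_diag (R : realType) (n d : nat) (e : 'I_n * 'I_n) :
  e.1 != e.2 -> unit_diag (CZ R d e).
Proof.
move=> e12.
exists (\row_a omega R d ^+ (tens_idx a e.2 * tens_idx a e.1)); last first.
  by move=> j; rewrite mxE normrX norm_omega expr1n.
pose v (k : 'I_d) l : 'rV[R[i]]_d := if l == e.1 then delta_mx 0 k
  else if l == e.2 then \row_(j < d) omega R d ^+ (j * k) else const_mx 1.
have -> : CZ R d e = \sum_k tens_op (fun l => diag_mx (v k l)).
  apply: eq_bigr => k _; congr tens_op; apply/funext => l; rewrite /v.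
  case: ifP => _.
    apply/matrixP => i j; rewrite !mxE eqxx /=.
    have [->|ij] := eqVneq i j; first by rewrite andbb mulr1n.
    rewrite mulr0n; case: eqVneq => // ik.
    by rewrite -ik [j == i]eq_sym (negPf ij).
  by case: ifP => _; rewrite ?ZopX ?diag_const_mx.
under eq_bigr do rewrite tens_op_diag.
rewrite -linear_sum; congr diag_mx; apply/rowP => a; rewrite summxE mxE.
rewrite (bigD1 (tens_idx a e.1))//= [X in _ + X]big1 ?addr0 ?mxE.
  rewrite (bigD1 e.1)//= (bigD1 e.2) 1?eq_sym//= big1 => [|l /andP[l1 l2]].
    by rewrite /v !eqxx eq_sym (negPf e12) !mxE !eqxx /= mul1r mulr1.
  by rewrite /v (negPf l1) (negPf l2) mxE.
move=> k ke; rewrite mxE (bigD1 e.1)//= /v eqxx mxE eqxx /= eq_sym.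
by rewrite (negPf ke) mul0r.
Qed.

(** The gates change only phases, so each of the [d ^ n] amplitudes keeps the squared modulus
    [d ^ (- n)] it has in the product of [ket_plus]. *)
Lemma graph_state_normalized (R : realType) (n d : nat)
    (E : {set 'I_n * 'I_n}) (m : 'I_n * 'I_n -> 'I_d) :
  (0 < d)%N -> edge_set E ->
  (graph_state R E m)^t* *m graph_state R E m = 1%:M.
Proof.
move=> d0 hE.
have [v Ev hv] : unit_diag (\prod_(e in E) CZ R d e ^+ m e).
  apply: (big_ind (@unit_diag R _)); [exact: unit_diag1|exact: unit_diagM|].
  move=> e /hE e12; apply/unit_diagX/CZ_unit_diag.
  by rewrite -val_eqE neq_ltn e12.
have dC : (((Num.sqrt d%:R)^-1)%:C * ((Num.sqrt d%:R)^-1)%:C) * d%:R = 1 :> R[i].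
  rewrite -(rmorph_nat (real_complex R)) -!rmorphM /= -invfM -expr2 sqr_sqrtr ?ler0n//.
  by rewrite mulVf ?pnatr_eq0 -?lt0n.
have cR : ((Num.sqrt d%:R)^-1)%:C \is @Num.real R[i].
  by apply/complex_realP; eexists.
have gE a : graph_state R E m a ord0 = v ord0 a * (((Num.sqrt d%:R)^-1)%:C) ^+ n.
  rewrite /graph_state Ev mul_diag_mx !mxE; congr (_ * _).
  by under eq_bigr do rewrite mxE; rewrite prodr_const card_ord.
apply/matrixP => i j; rewrite !ord1 [LHS]mxE [RHS]mxE.
under eq_bigr => a _.
  rewrite mxE mxE gE rmorphM mulrACA [_^* * _]mulrC -normCK hv expr1n mul1r.
  rewrite rmorphXn /= (conj_Creal cR) -exprMn.
  over.
rewrite sumr_const card_ord /tensdim card_ffun !card_ord -[_ *+ (_ ^ _)]mulr_natr natrX -exprMn dC.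
by rewrite expr1n.
Qed.

(** * Traces against density operators, and sorting of configurations *)

Lemma adjM (R : realType) (m n p : nat) (A : 'M[R[i]]_(m, n)) (B : 'M[R[i]]_(n, p)) :
  (A *m B)^t* = B^t* *m A^t*.
Proof. by rewrite trmx_mul map_mxM. Qed.

Lemma Re_sum (R : realType) (I : finType) (F : I -> R[i]) :
  complex.Re (\sum_j F j) = \sum_j complex.Re (F j).
Proof. exact: (raddf_sum (@complex.Re R : {additive Rcomplex R -> R})). Qed.

Lemma Re_real_mul (R : realType) (x : R) (z : R[i]) :
  complex.Re (x%:C * z) = x * complex.Re z.
Proof. by case: z => a b /=; rewrite mul0r subr0. Qed.

(** By cyclicity the trace is that of [X^t* *m rho *m X], whose diagonal entries are values of the
    form of [rho] at the columns of [X]. *)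
Lemma Re_trace_proj_ge0 (R : realType) (D : nat) (X rho : 'M[R[i]]_D) :
  density_op rho -> X *m X = X -> X^t* = X -> 0 <= complex.Re (\tr (X *m rho)).
Proof.
move=> [rho0 _] XX XH.
suff : 0 <= \tr (X *m rho) by rewrite lecE => /andP[].
rewrite -XX -mulmxA mxtrace_mulC -[X in X *m _ *m _]XH.
apply: sumr_ge0 => j _.
have -> : (X^t* *m rho *m X) j j = ((col j X)^t* *m rho *m col j X) ord0 ord0.
  rewrite [LHS]mxE [RHS]mxE; apply: eq_bigr => k _; rewrite !mxE; congr (_ * _).
  by apply: eq_bigr => l _; rewrite !mxE.
exact: rho0.
Qed.

Lemma Re_trace_perm (R : realType) (n D : nat) (s : 'S_n) (A : 'I_n -> 'M[R[i]]_D)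
    (rho : 'M[R[i]]_(tensdim n D)) :
  perm_invariant rho ->
  \tr (tens_op (fun l => A (s l)) *m rho) = \tr (tens_op A *m rho).
Proof.
move=> inv.
(* Unitarity is the conjugation formula applied to a tensor power of the identity. *)
have UU : (perm_op R[i] D s)^t* *m perm_op R[i] D s = 1%:M.
  have := @perm_op_conj R n D s (fun=> 1%:M).
  by rewrite !tens_op1 [X in X *m _]mulmx1 => /mulmx1C.
rewrite -(perm_op_conj s A); set P := perm_op _ _ _ in UU *.
transitivity (\tr (P *m (tens_op A *m rho) *m P^t*)).
  rewrite -[in LHS](inv s) -/P !mulmxA.
  by rewrite -[P *m _ *m _ *m P]mulmxA UU mulmx1.
by rewrite mxtrace_mulC !mulmxA UU mul1mx.
Qed.

Lemma perm_eq_bool (s t : seq bool) :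
  size s = size t -> count id s = count id t -> perm_eq s t.
Proof.
move=> st cst; apply/seq.permP => a.
have E (u : seq bool) : count a u = (a true * count id u + a false * count negb u)%N.
  elim: u => [|[] u /= ->]; rewrite ?muln0 // ?add1n ?add0n ?mulnS; lia.
rewrite !E cst; congr (_ + _ * _)%N.
by apply/eqP; rewrite -(eqn_add2l (count id s)) (count_predC id s) cst (count_predC id t) st.
Qed.

(** Sorting a configuration moves its marked positions to the front, the normal form used by
    [fail_weight]. *)
Lemma exists_perm_bool (n : nat) (c : {ffun 'I_n -> bool}) :
  exists s : 'S_n, forall l, c l = (s l < #|[pred l | c l]|)%N.
Proof.
pose t := [tuple (i < #|[pred l | c l]|)%N | i < n].
have /tuple_permP[s hs] : perm_eq [tuple c i | i < n] t.
  apply: perm_eq_bool; first by rewrite !size_tuple.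
  have cE (f : 'I_n -> bool) : count id [tuple f i | i < n] = (\sum_(i < n | f i) 1)%N.
    by rewrite count_map val_ord_tuple -sum1_count big_enum_cond.
  rewrite !cE sum1_card.
  have zn : (#|[pred l | c l]| <= n)%N by rewrite -[leqRHS]card_ord max_card.
  by rewrite -(big_ord_widen n (fun=> 1%N) zn) sum1_card card_ord.
exists s => l.
have := congr1 (fun u => tnth u l) (val_inj hs).
by rewrite !tnth_mktuple.
Qed.

(** * Permutation-invariant states *)

(* For permutation-invariant rho, the weight of any single configuration with z
   systems in the range of Q. *)
Definition fail_weight (R : realType) (M D : nat) (P Q : 'M[R[i]]_D)
    (rho : 'M[R[i]]_(tensdim M D)) (z : nat) : R :=
  complex.Re (\tr (tens_op (fun l : 'I_M => if (l < z)%N then Q else P) *m rho)).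

(** Expand over all choices of [P] or [Q] per factor. By invariance each trace depends only on the
    number of [Q], which the power of ['X] records. *)
Lemma Re_trace_tens_op (R : realType) (M D : nat) (P Q : 'M[R[i]]_D)
    (rho : 'M[R[i]]_(tensdim M D)) (x y : 'I_M -> R) :
  perm_invariant rho ->
  complex.Re (\tr (tens_op (fun l => (x l)%:C *: P + (y l)%:C *: Q) *m rho))
  = \sum_(z < M.+1) (\prod_l ((x l)%:P + y l *: 'X))`_z * fail_weight P Q rho z.
Proof.
move=> inv.
pose co (c : {ffun 'I_M -> bool}) : R := \prod_l (if c l then y l else x l).
pose nb (c : {ffun 'I_M -> bool}) := #|[pred l | c l]|.
have -> : tens_op (fun l => (x l)%:C *: P + (y l)%:C *: Q)
   = \sum_(c : {ffun 'I_M -> bool}) (co c)%:C *: tens_op (fun l => if c l then Q else P).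
  transitivity (tens_op (fun l => \sum_(b : bool)
      (if b then (y l)%:C else (x l)%:C) *: (if b then Q else P))).
    by congr tens_op; apply/funext => l; rewrite big_bool addrC.
  rewrite tens_op_sum; apply: eq_bigr => c _; rewrite tens_opZ rmorph_prod.
  by congr (_ *: _); apply: eq_bigr => l _; case: (c l).
have -> : \prod_l ((x l)%:P + y l *: 'X)
   = \sum_(c : {ffun 'I_M -> bool}) co c *: 'X^(nb c).
  transitivity (\prod_l \sum_(b : bool) (if b then y l *: 'X else (x l)%:P)).
    by apply: eq_bigr => l _; rewrite big_bool addrC.
  rewrite bigA_distr_bigA; apply: eq_bigr => c _.
  rewrite /nb -sum1_card -prodrXr /co [X in _ *: X]big_mkcond -scaler_prod.
  apply: eq_bigr => l _; rewrite inE.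
  by case: (c l); rewrite ?expr1// alg_polyC.
rewrite mulmx_suml (raddf_sum (@mxtrace _ _)) Re_sum.
under [RHS]eq_bigr do rewrite coef_sum mulr_suml.
rewrite exchange_big; apply: eq_bigr => c _ /=.
rewrite -scalemxAl mxtraceZ Re_real_mul.
have [s hs] := exists_perm_bool c.
have zM : (nb c < M.+1)%N by rewrite ltnS -[leqRHS]card_ord max_card.
rewrite (bigD1 (Ordinal zM))//= coefZ coefXn eqxx mulr1 big1 ?addr0; last first.
  move=> z zn; rewrite coefZ coefXn -val_eqE /= in zn *.
  by rewrite (negPf zn) mulr0 mul0r.
congr (_ * _); rewrite /fail_weight.
rewrite -(Re_trace_perm s (fun l => if (l < nb c)%N then Q else P) inv).
by congr (complex.Re (\tr (tens_op _ *m _))); apply/funext => l; rewrite hs.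
Qed.

Lemma fail_weight_ge0 (R : realType) (M D : nat) (P Q : 'M[R[i]]_D)
    (rho : 'M[R[i]]_(tensdim M D)) z : density_op rho ->
  P *m P = P -> P^t* = P -> Q *m Q = Q -> Q^t* = Q ->
  0 <= fail_weight P Q rho z.
Proof.
move=> dens PP PH QQ QH; apply: Re_trace_proj_ge0 => //.
  by rewrite tens_opM; congr tens_op; apply/funext => l; case: ifP.
by rewrite tens_op_adj; congr tens_op; apply/funext => l; case: ifP.
Qed.

(** With all coefficients 1, the operator is the identity and the polynomial is [(1 + 'X) ^+ M]. *)
Lemma sum_fail_weight (R : realType) (M D : nat) (P Q : 'M[R[i]]_D)
    (rho : 'M[R[i]]_(tensdim M D)) :
  density_op rho -> perm_invariant rho -> P + Q = 1%:M ->
  \sum_(z < M.+1) 'C(M, z)%:R * fail_weight P Q rho z = 1.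
Proof.
move=> [_ tr1] inv PQ.
have := @Re_trace_tens_op R M D P Q rho (fun=> 1) (fun=> 1) inv.
under eq_fun do rewrite !scale1r PQ.
rewrite tens_op1 mul1mx tr1 /= => E; rewrite [RHS]E; apply: eq_bigr => z _.
rewrite prodr_const card_ord scale1r polyC1 exprDn; congr (_ * _).
have -> : \sum_(i < M.+1) 1 ^+ (M - i) * 'X^i *+ 'C(M, i)
    = \poly_(i < M.+1) 'C(M, i)%:R :> {poly R}.
  by rewrite poly_def; apply: eq_bigr => i _; rewrite expr1n mul1r scaler_nat.
by rewrite coef_poly ltn_ord.
Qed.

(** * Generating function of the tests *)

Lemma bin_mul_bin (n i j : nat) : (i <= j)%N ->
  ('C(n, i) * 'C(n - i, j - i) = 'C(n, j) * 'C(j, i))%N.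
Proof.
move=> ij; case: (leqP j n) => jn; last first.
  rewrite (bin_small jn) mul0n; case: (ltnP n i) => ni.
    by rewrite (bin_small ni).
  by have /bin_small -> : (n - i < j - i)%N by [lia]; rewrite muln0.
have f0 : (0 < i`! * (j - i)`! * (n - j)`!)%N by rewrite !muln_gt0 !fact_gt0.
apply/eqP; rewrite -(eqn_pmul2r f0); apply/eqP.
have h1 := bin_fact (leq_trans ij jn); have h2 := bin_fact jn; have h3 := bin_fact ij.
have ij' : (j - i <= n - i)%N by lia.
have h4 := bin_fact ij'; have E : (n - i - (j - i) = n - j)%N by lia.
rewrite E in h4.
transitivity ('C(n, i) * (i`! * ('C(n - i, j - i) * ((j - i)`! * (n - j)`!))))%N; first by ring.
rewrite h4 h1 -h2 -h3; ring.
Qed.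

Lemma coef_linear_exp (R : comNzRingType) (a : R) (m j : nat) :
  ((1 + a *: 'X) ^+ m)`_j = 'C(m, j)%:R * a ^+ j.
Proof.
have -> : (1 + a *: 'X) ^+ m = \poly_(i < m.+1) ('C(m, i)%:R * a ^+ i).
  rewrite poly_def exprDn; apply: eq_bigr => i _.
  by rewrite expr1n mul1r exprZn -scalerA scaler_nat.
rewrite coef_poly; case: ltnP => // mj.
by rewrite bin_small ?mul0r.
Qed.

(* The coefficient of X^z is the total weight, over the choices of at most k
   failing tests, of the configurations with z of the N tested systems in the
   range of Q: such a system contributes lambda to a passed test and 1 - lambda to
   a failed one, and a system in the range of P contributes 1 and 0. *)
Definition pass_gf (R : realType) (k N : nat) (lambda : R) : {poly R} :=
  \sum_(i < k.+1) 'C(N, i)%:R *: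
    ((1 + lambda *: 'X) ^+ (N - i) * ((1 - lambda) *: 'X) ^+ i).

(** Choosing the failed tests first and then the other systems in the range of [Q] amounts to
    choosing all [z] such systems first and the failures among them afterwards. *)
Lemma coef_pass_gf (R : realType) (k N z : nat) (lambda : R) :
  (pass_gf k N lambda)`_z = 'C(N, z)%:R * binom_cdf z k (1 - lambda).
Proof.
rewrite coef_sum mulr_sumr; apply: eq_bigr => i _.
rewrite coefZ exprZn -scalerAr coefZ coefMXn.
case: ltnP => zi; first by rewrite (bin_small zi) !(mul0r, mulr0).
rewrite coef_linear_exp subKr.
transitivity (('C(N, i) * 'C(N - i, z - i))%:R * (1 - lambda) ^+ i * lambda ^+ (z - i)).
  by rewrite natrM; ring.
by rewrite bin_mul_bin// natrM; ring.
Qed.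

Lemma prod_three_blocks (R : pzSemiRingType) (N i : nat) (a b c : R) : (i <= N)%N ->
  \prod_(l < N.+1) (if (l < N - i)%N then a else if (l < N)%N then b else c)
  = a ^+ (N - i) * b ^+ i * c.
Proof.
move=> iN.
rewrite big_ord_recr /= ltnn ifF; last by rewrite ltnNge leq_subr.
congr (_ * _).
rewrite -(big_mkord xpredT (fun l => if (l < N - i)%N then a else if (l < N)%N then b else c)).
rewrite (big_cat_nat (leq0n (N - i)) (leq_subr i N)) /=; congr (_ * _).
  rewrite (eq_big_nat _ _ (F2 := fun=> a)); last by move=> l /andP[_ ->].
  by rewrite prodr_const_nat subn0.
rewrite (eq_big_nat _ _ (F2 := fun=> b)); last first.
  by move=> l /andP[Nl ->]; rewrite ltnNge Nl.
by rewrite prodr_const_nat subKn.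
Qed.

(** * From the tests to the conditional fidelity *)

Lemma ket_projH (R : realType) (D : nat) (G : 'cV[R[i]]_D) :
  (ket_proj G)^t* = ket_proj G.
Proof. by rewrite /ket_proj adjM trmxCK. Qed.

Lemma ket_proj_idem (R : realType) (D : nat) (G : 'cV[R[i]]_D) :
  G^t* *m G = 1%:M -> ket_proj G *m ket_proj G = ket_proj G.
Proof.
by move=> G1; rewrite /ket_proj mulmxA -[X in X *m _]mulmxA G1 mulmx1.
Qed.

Lemma co_ket_projH (R : realType) (D : nat) (G : 'cV[R[i]]_D) :
  (1%:M - ket_proj G)^t* = 1%:M - ket_proj G.
Proof.
by rewrite linearB /= map_mxB trmx1 map_mx1 ket_projH.
Qed.

Lemma co_ket_proj_idem (R : realType) (D : nat) (G : 'cV[R[i]]_D) : G^t* *m G = 1%:M ->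
  (1%:M - ket_proj G) *m (1%:M - ket_proj G) = 1%:M - ket_proj G.
Proof.
move=> G1.
by rewrite mulmxBl mul1mx mulmxBr mulmx1 ket_proj_idem// subrr subr0.
Qed.

(** A general last factor treats both quantities at once: [x = y = 1] gives [pass_prob], and
    [x = 1], [y = 0] gives [pass_fid]. *)
Lemma sum_test_op (R : realType) (D : nat) (G : 'cV[R[i]]_D)
    (lambda : R) (N k : nat) (x y : R) (rho : 'M[R[i]]_(tensdim N.+1 D)) :
  let P := ket_proj G in let Q := 1%:M - P in perm_invariant rho ->
  \sum_(i < k.+1) 'C(N, i)%:R *
    complex.Re (\tr (test_op G lambda N i (x%:C *: P + y%:C *: Q) *m rho))
  = \sum_(z < N.+2) (pass_gf k N lambda * (x%:P + y *: 'X))`_z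
      * fail_weight P Q rho z.
Proof.
move=> P Q inv.
under [RHS]eq_bigr do rewrite mulr_suml coef_sum mulr_suml.
rewrite exchange_big; apply: eq_bigr => i _ /=.
under [RHS]eq_bigr do rewrite -scalerAl coefZ -mulrA.
rewrite -mulr_sumr; case: (leqP i N) => iN; last by rewrite bin_small// !mul0r.
congr (_ * _).
pose X l := if (l < N - i)%N then 1 else if (l < N)%N then 0 else x.
pose Y l := if (l < N - i)%N then lambda else if (l < N)%N then 1 - lambda else y.
have -> : test_op G lambda N i (x%:C *: P + y%:C *: Q)
    = tens_op (fun l : 'I_N.+1 => (X l)%:C *: P + (Y l)%:C *: Q).
  congr tens_op; apply/funext => l; rewrite /X /Y.
  have sE : strategy G lambda = P + lambda%:C *: Q by [].
  case: ifP => _; first by rewrite sE scale1r.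
  case: ifP => _ //; rewrite /co_strategy sE scale0r add0r rmorphB scalerBl scale1r.
  by rewrite /Q opprD addrA.
rewrite (Re_trace_tens_op P Q (fun l : 'I_N.+1 => X l) (fun l : 'I_N.+1 => Y l) inv).
apply: eq_bigr => z _; congr ((polyseq _)`_z * _).
rewrite -prod_three_blocks//; apply: eq_bigr => l _; rewrite /X /Y.
by case: ifP => _ //; case: ifP => _ //; rewrite add0r.
Qed.

Lemma pass_probE (R : realType) (D : nat) (G : 'cV[R[i]]_D) (lambda : R)
    (N k : nat) (rho : 'M[R[i]]_(tensdim N.+1 D)) : perm_invariant rho ->
  pass_prob G lambda k rho
  = \sum_(z < N.+2) (pass_gf k N lambda * (1 + 'X))`_z
      * fail_weight (ket_proj G) (1%:M - ket_proj G) rho z.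
Proof.
move=> inv; have := sum_test_op G lambda k 1 1 inv.
by rewrite /= !scale1r [_ + (1%:M - _)]addrC subrK polyC1 => <-.
Qed.

Lemma pass_fidE (R : realType) (D : nat) (G : 'cV[R[i]]_D) (lambda : R)
    (N k : nat) (rho : 'M[R[i]]_(tensdim N.+1 D)) : perm_invariant rho ->
  pass_fid G lambda k rho
  = \sum_(z < N.+2) (pass_gf k N lambda)`_z
      * fail_weight (ket_proj G) (1%:M - ket_proj G) rho z.
Proof.
move=> inv; have := sum_test_op G lambda k 1 0 inv.
by rewrite /= !scale1r !scale0r !addr0 polyC1 mulr1 => <-.
Qed.

(** Averaging the linear bound over the weights gives [(N + 1) (p - f) <= a q + (T - a) delta] with
    [T = eps (N + 1)]; then [q <= p] and [delta <= p] raise the right side to [T p]. *)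
Lemma cond_fidelity_ge (R : realType) (D : nat) (G : 'cV[R[i]]_D)
    (lambda : R) (N k : nat) (eps delta a : R)
    (rho : 'M[R[i]]_(tensdim N.+1 D)) :
  G^t* *m G = 1%:M ->
  0 <= lambda <= 1 -> 0 < delta -> 0 <= a <= eps * N.+1%:R ->
  (forall z, z%:R * binom_cdf z.-1 k (1 - lambda)
    <= a * binom_cdf z k (1 - lambda) + (eps * N.+1%:R - a) * delta) ->
  density_op rho -> perm_invariant rho -> delta <= pass_prob G lambda k rho ->
  1 - eps <= cond_fidelity G lambda k rho.
Proof.
move=> G1 l01 d0 /andP[a0 aT] gap dens inv dp.
set p := pass_prob _ _ _ _ in dp *; have p0 : 0 < p := lt_le_trans d0 dp.
rewrite /cond_fidelity ler_pdivlMr// -/p.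
set B := fun z => binom_cdf z k (1 - lambda).
set w := fail_weight (ket_proj G) (1%:M - ket_proj G) rho.
have nu01 : 0 <= 1 - lambda <= 1 by lra.
have w0 z : 0 <= w z.
  by apply: fail_weight_ge0 => //; [exact: ket_proj_idem|exact: ket_projH
    |exact: co_ket_proj_idem|exact: co_ket_projH].
have wsum : \sum_(z < N.+2) 'C(N.+1, z)%:R * w z = 1.
  by apply: sum_fail_weight => //; rewrite addrC subrK.
set q := \sum_(z < N.+2) 'C(N.+1, z)%:R * B z * w z.
(* Pascal's rule splits ['C(N.+1, z)], and [B z <= B z.-1] handles the part where the untested
   system is in the range of [Q]. *)
have qp : q <= p.
  rewrite /p pass_probE//; apply: ler_sum => z _; apply: ler_wpM2r => //.
  rewrite mulrDr mulr1 coefD coefMX !coef_pass_gf -!/(B _).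
  case: z => -[|z] /= _; first by rewrite !bin0 addr0.
  rewrite binS natrD mulrDl lerD2l ler_wpM2l//.
  exact: binom_cdf_succ_le.
(* Only the summand with ['X] survives in the difference, and
   [N.+1 * 'C(N, z.-1) = z * 'C(N.+1, z)]. *)
have pf : N.+1%:R * (p - pass_fid G lambda k rho)
    = \sum_(z < N.+2) 'C(N.+1, z)%:R * (z%:R * B z.-1) * w z.
  rewrite /p pass_probE// pass_fidE// -sumrB mulr_sumr; apply: eq_bigr => z _.
  rewrite -mulrBl [LHS]mulrA (mulrDr (pass_gf _ _ _)) mulr1 coefD addrAC subrr add0r
    coefMX coef_pass_gf -/(B _).
  congr (_ * _); case: z => -[|z] /= _; first by rewrite mulr0n mul0r !mulr0.
  by rewrite !mulrA -!natrM mul_bin_diag mulnC.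
have main : N.+1%:R * (p - pass_fid G lambda k rho)
    <= a * q + (eps * N.+1%:R - a) * delta.
  have -> : (eps * N.+1%:R - a) * delta
      = \sum_(z < N.+2) (eps * N.+1%:R - a) * delta * ('C(N.+1, z)%:R * w z).
    by rewrite -mulr_sumr wsum mulr1.
  rewrite pf /q mulr_sumr -big_split /=.
  apply: ler_sum => z _; rewrite !mulrA -mulrDl; apply: ler_wpM2r => //.
  rewrite -[leLHS]mulrA.
  apply: le_trans (_ : 'C(N.+1, z)%:R * (a * B z + (eps * N.+1%:R - a) * delta) <= _).
    by rewrite ler_wpM2l// gap.
  by rewrite le_eqVlt; apply/orP; left; apply/eqP; ring.
have h1 := ler_wpM2l a0 qp.
have aT' : 0 <= eps * N.+1%:R - a by rewrite subr_ge0.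
have h2 := ler_wpM2l aT' dp.
have N0 : 0 < N.+1%:R :> R by rewrite ltr0n.
rewrite -(ler_pM2l N0); lra.
Qed.

(** Witness that the feasible set is nonempty, so that its infimum is a genuine one. Only the weight
    at [z = 0] is nonzero. *)
Lemma honest_state_feasible (R : realType) (D : nat) (G : 'cV[R[i]]_D)
    (lambda : R) (N k : nat) :
  G^t* *m G = 1%:M -> let rho := tens_op (fun _ : 'I_N.+1 => ket_proj G) in
  [/\ density_op rho, perm_invariant rho & pass_prob G lambda k rho = 1].
Proof.
move=> G1 rho; set P := ket_proj G in rho *.
have PP : P *m P = P := ket_proj_idem G1; have PH : P^t* = P := ket_projH G.
have inv : perm_invariant rho by move=> s; rewrite perm_op_conj.
have trP : \tr P = 1.
  by rewrite /P /ket_proj mxtrace_mulC G1 mxtrace1.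
have trQP : \tr ((1%:M - P) *m P) = 0.
  by rewrite mulmxBl mul1mx PP subrr mxtrace0.
split=> //; first split.
- move=> v.
  have rr : rho *m rho = rho.
    by rewrite /rho tens_opM; congr tens_op; apply/funext => l.
  have rH : rho^t* = rho.
    by rewrite /rho tens_op_adj; congr tens_op; apply/funext => l.
  rewrite -rr -{1}rH mulmxA -mulmxA -adjM mxE; apply: sumr_ge0 => j _.
  by rewrite !mxE mulrC mul_conjC_ge0.
- by rewrite mxtrace_tens_op trP prodr_const expr1n.
rewrite pass_probE// big_ord_recl big1 ?addr0 => [|z _].
  rewrite /fail_weight tens_opM mxtrace_tens_op.
  rewrite big1 => [|l _]; last by rewrite PP.
  rewrite mulr1 mulrDr mulr1 coefD coefMX /= addr0 coef_pass_gf bin0 mul1r.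
  rewrite /binom_cdf big_ord_recl big1 => [|j _]; last by rewrite bin0n !mul0r.
  by rewrite bin0 !expr0 !mulr1 addr0.
rewrite /fail_weight tens_opM mxtrace_tens_op.
by rewrite (bigD1 ord0)//= trQP mul0r mulr0.
Qed.

Theorem theorem3 (R : realType) (d n : nat) (d_prime : prime d)
    (n_gt0 : (0 < n)%N) (E : {set 'I_n * 'I_n}) (E_edges : edge_set E)
    (m : 'I_n * 'I_n -> 'I_d) (lambda nu eps delta r : R)
    (lambda01 : 0 < lambda < 1) (eps01 : 0 < eps < 1)
    (delta_bd : 0 < delta <= 1 / 2) (r_bd : 0 <= r < 1)
    (nuE : nu = 1 - lambda) (N k : nat)
    (kE : k%:Z = Num.floor ((lambda * Num.sqrt (2 * nu) + r)
                            / (lambda * Num.sqrt (2 * nu) + 1) * nu * eps * N%:R))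
    (N_bd : N%:Z >= Num.ceil (((lambda * Num.sqrt (2 * nu) + 1)
                               / (lambda * nu * (1 - r))) ^+ 2
                              * ((ln (delta^-1) + 4 * lambda * nu ^+ 2) / eps))) :
  guaranteed_infidelity (graph_state R E m) lambda k N delta <= eps
  /\ binom_cdf N k (nu * r * eps) >= 1 - delta.
Proof.
have [d0 d12] := andP delta_bd; have [r0 r1] := andP r_bd.
have [l0 l1] := andP lambda01; have [e0 e1] := andP eps01.
have nu0 : 0 < nu by lra.
set A := lambda * Num.sqrt (2 * nu) in kE N_bd.
set s := (A + r) / (A + 1) in kE.
have A0 : 0 < A by rewrite mulr_gt0 ?sqrtr_gt0 ?mulr_gt0.
(* This value of [A] makes the robustness exponent [nu eps N (s - r)^2 / 2] equal to the soundness
   exponent [(lambda nu (1 - s))^2 eps N], since [s - r = A (1 - s)]. *)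
have A2 : A ^+ 2 = 2 * lambda ^+ 2 * nu.
  by rewrite /A exprMn sqr_sqrtr ?mulr_ge0// ?ltW//; ring.
have s1E : 1 - s = (1 - r) / (A + 1) by rewrite /s; field; lra.
have s0 : 0 < s by rewrite divr_gt0; lra.
have s1 : 0 < 1 - s by rewrite s1E divr_gt0; lra.
have srE : s - r = A * (1 - s) by rewrite s1E /s; field; lra.
have lnd : 0 < ln delta^-1 by rewrite ln_gt0// invf_gt1//; lra.
have kle : k%:R <= s * nu * eps * N%:R.
  by have := floor_le (s * nu * eps * N%:R); rewrite -kE.
(* Robustness uses this strict half of the floor: more than [k] failures means at least [k + 1]. *)
have ltk : s * nu * eps * N%:R < k.+1%:R.
  by have := floorD1_gt (s * nu * eps * N%:R); rewrite -kE -PoszD addn1.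
have Nbig : ln delta^-1 + 4 * lambda * nu ^+ 2 <= (lambda * nu * (1 - s)) ^+ 2 * (eps * N%:R).
  move: N_bd; rewrite ceil_le_int -pmulrn => NX.
  have c0 : 0 < (lambda * nu * (1 - s)) ^+ 2 * eps.
    by rewrite !(mulr_gt0, exprn_gt0).
  move: NX; rewrite -(ler_pM2l c0) s1E; congr (_ <= _); last by rewrite mulrA.
  by field; rewrite !gt_eqF//; lra.
have lnuN : ln delta^-1 <= (lambda * nu * (1 - s)) ^+ 2 * (eps * N%:R).
  apply: le_trans _ Nbig; rewrite lerDl !mulr_ge0 ?sqr_ge0// ltW//.
have N0 : 0 <= N%:R :> R by rewrite ler0n.
have G1 : (graph_state R E m)^t* *m graph_state R E m = 1%:M.
  by apply: graph_state_normalized => //; exact: prime_gt0.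
split.
(* Soundness concerns [N + 1] systems, so [T = eps * N.+1]; the bounds known for [eps * N] carry
   over by monotonicity. *)
- have eN : eps * N%:R <= eps * N.+1%:R by rewrite ler_pM2l// ler_nat.
  have [||||a aT gap] := @truncated_gap R lambda s (eps * N.+1%:R) delta k lambda01.
  + by lra.
  + by rewrite d0.
  + rewrite -nuE; apply: le_trans kle _.
    by rewrite -[leLHS]mulrA ler_wpM2l// mulr_ge0// ltW.
  + rewrite -nuE; apply: le_trans lnuN _.
    by rewrite ler_wpM2l// sqr_ge0.
  rewrite /guaranteed_infidelity lerBlDr -lerBlDl.
  have l01 : 0 <= lambda <= 1 by rewrite !ltW.
  apply: lb_le_inf.
    have [dens inv pass1] := honest_state_feasible lambda N k G1.
    by eexists; eexists; split; [exact: dens|exact: inv|rewrite pass1; lra|reflexivity].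
  move=> _ [rho [dens inv dp ->]].
  exact: (cond_fidelity_ge G1 l01 d0 aT gap).
- have G0 : 0 <= nu * eps * N%:R by rewrite !mulr_ge0// ltW.
  apply: (@binom_cdf_poisson_tail R N k _ r s (nu * eps * N%:R)) => //.
  + by rewrite !mulr_ge0 ?mulr_ile1 ?mulr_ge0 // ?ltW//; lra.
  + by rewrite r0 -subr_gt0 srE mulr_gt0.
  + lra.
  + ring.
  + by move: r0; rewrite le_eqVlt => /orP[/eqP <-|]; [left; ring | right].
  + by rewrite !mulrA ltW.
  + apply: le_trans lnuN _; rewrite srE [(A * _) ^+ 2]exprMn A2.
    by rewrite le_eqVlt; apply/orP; left; apply/eqP; field.
Qed.
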